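(* Let $k$ and $i$ be integers with $1\le i\le k/2$, $k\equiv 2\pmod 4$ and $i\equiv 1\pmod 4$. Then for all integers $n\ge 0$, $$S_{k,i}(4n+3)\equiv 0\pmod 4.$$
   Context: Write $(a;q)_\infty=\prod_{m\ge 0}(1-aq^m)$, $(a)_\infty=(a;q)_\infty$, and $(a_1,\ldots,a_r;q)_\infty=(a_1;q)_\infty\cdots(a_r;q)_\infty$. For integers $k,i$ with $1\le i\le k/2$, the integers $S_{k,i}(n)$, $n\ge 0$, are given by the generating function $$\sum_{n\ge 0}S_{k,i}(n)q^n=\frac{(-q)_\infty\,(q^i,q^{k-i},q^k;q^k)_\infty}{(q)_\infty}.$$ Combinatorially (an overpartition of $n$ is a partition of $n$ in which the first occurrence of each integer may be overlined): if $i<k/2$, $S_{k,i}(n)$ is the number of overpartitions of $n$ whose non-overlined parts are not congruent to $0,\pm i$ modulo $k$; if $i=k/2$, it is the number of overpartitions of $n$ with no part divisible by $k/2$. *)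

(* Defs.v *)
From HB Require Import structures.
From mathcomp Require Import all_boot all_order all_algebra.
Set Implicit Arguments.
Unset Strict Implicit.
Unset Printing Implicit Defensive.
Import Order.TTheory GRing.Theory Num.Theory.
Local Open Scope ring_scope.

(* Formal power series in q with integer coefficients: f n is the coefficient
   of q^n. Polynomials in q are elements of {poly int}, with 'X standing
   for q. *)
Definition fps := nat -> int.

Definition fps_one : fps := fun n => (n == 0%N)%:R.

Definition fps_mul (f g : fps) : fps :=
  fun n => \sum_(j < n.+1) f j * g (n - j)%N.

(* The first n coefficients of 1/f, obtained by solving f * g = 1 for
   g_0, g_1, ... successively. *)
Fixpoint fps_inv_coefs (f : fps) (n : nat) : seq int :=
  if n is m.+1 then
    let s := fps_inv_coefs f m in
    rcons s (((m == 0%N)%:R - \sum_(j < m) s`_j * f (m - j)%N) / f 0%N)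
  else [::].

(* Meaningful only when f 0 is a unit of int; see fps_invP. *)
Definition fps_inv (f : fps) : fps := fun n => (fps_inv_coefs f n.+1)`_n.

Definition fps_div (f g : fps) : fps := fps_mul f (fps_inv g).

(* (a; p)_oo = \prod_(m >= 0) (1 - a p^m) as a formal power series, for p
   without constant term. The factors with m > n do not affect the coefficient
   of q^n, which is therefore read off the product of the first n + 1 factors;
   see qpoch_stable. *)
Definition qpoch (a p : {poly int}) : fps :=
  fun n => (\prod_(m < n.+1) (1 - a * p ^+ m))`_n.

(* (a_1, ..., a_r; p)_oo *)
Definition qpochs (s : seq {poly int}) (p : {poly int}) : fps :=
  \big[fps_mul/fps_one]_(a <- s) qpoch a p.

Definition Ski (k i : nat) : fps :=
  fps_div
    (fps_mul (qpoch (- 'X) 'X) (qpochs [:: 'X^i; 'X^(k - i); 'X^k] 'X^k))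
    (qpoch 'X 'X).

Lemma qpoch_stable (a p : {poly int}) (n N : nat) :
  p`_0 = 0 -> (n < N)%N ->
  (\prod_(m < N) (1 - a * p ^+ m))`_n = qpoch a p n.
Proof.
move=> p0 /subnKC <-; rewrite /qpoch; elim: (N - n.+1)%N => [|d IHd].
  by rewrite addn0.
rewrite addnS big_ord_recr /= mulrBr mulr1 coefB IHd.
have [r ->] : exists r, p = r * 'X.
  have /factor_theorem[r ->] : root p 0 by rewrite /root horner_coef0 p0.
  by exists r; rewrite subr0.
by rewrite exprMn !mulrA coefMXn addSn ltnS leq_addr subr0.
Qed.

Lemma size_fps_inv_coefs f n : size (fps_inv_coefs f n) = n.
Proof. by elim: n => //= n IHn; rewrite size_rcons IHn. Qed.

Lemma nth_fps_inv_coefs f n j :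
  (j < n)%N -> (fps_inv_coefs f n)`_j = fps_inv f j.
Proof.
elim: n => // n IHn; rewrite ltnS leq_eqVlt => /predU1P[-> //|lt_jn].
by rewrite /= nth_rcons size_fps_inv_coefs lt_jn IHn.
Qed.

Lemma fps_invP f : f 0%N \is a GRing.unit ->
  fps_mul (fps_inv f) f =1 fps_one.
Proof.
move=> f0 n; rewrite /fps_mul big_ord_recr /= subnn {2}/fps_inv /=.
rewrite nth_rcons size_fps_inv_coefs ltnn eqxx divrK //.
rewrite (eq_bigr (fun j : 'I_n => (fps_inv_coefs f n)`_j * f (n - j)%N)).
  by rewrite addrC subrK.
by move=> j _; rewrite nth_fps_inv_coefs.
Qed.

Lemma qpochXX_unit : qpoch 'X 'X 0%N \is a GRing.unit.
Proof. by rewrite /qpoch big_ord1 expr0 mulr1 coefB coef1 coefX subr0. Qed.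

(* Main.v *)
(** Let A be the triple product (q^i, q^(k-i), q^k; q^k)_oo and phi the one for
    (k, i) = (2, 1), which is Gauss' theta series (q)_oo / (-q)_oo; thus
    phi * S = A. The Jacobi triple product writes A as the sum over all integers
    m of (-1)^m q^(k m(m-1)/2 + i m), and under the congruence hypotheses these
    exponents are m^2 modulo 4, hence 0 or 1. Since (q)_oo and (-q)_oo agree
    modulo 2, phi = 1 - 2T for some T, whose exponents are 0 or 1 modulo 4 as
    well. Then S = A + 2TS = A + 2TA + 4T^2 S, and neither A nor TA has a term
    whose exponent is 3 modulo 4. *)

Require Import Defs.
From mathcomp Require Import all_boot all_order all_algebra.
From mathcomp Require Import ring zify.

Set Implicit Arguments.
Unset Strict Implicit.
Unset Printing Implicit Defensive.
Import GRing.Theory.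
Local Open Scope ring_scope.

(** * q-binomial coefficients *)

Section QBinomial.
Variables (R : comNzRingType) (p : R).

(** Gaussian binomial coefficient in base [p]; the q-Pascal rule defines it in any ring, without
    division. *)
Fixpoint qbin (n s : nat) : R :=
  match n, s with
  | _, 0 => 1
  | 0, _.+1 => 0
  | n'.+1, s'.+1 => qbin n' s' + p ^+ s * qbin n' s
  end.

Lemma qbin0 n : qbin n 0 = 1. Proof. by case: n. Qed.

Lemma qbinS n s : qbin n.+1 s.+1 = qbin n s + p ^+ s.+1 * qbin n s.+1.
Proof. by []. Qed.

Lemma qbin_small n s : (n < s)%N -> qbin n s = 0.
Proof.
elim: n s => [|n IHn] [|s] //= lt_ns.
by rewrite !IHn ?mulr0 ?addr0 // ltnW.
Qed.

Lemma qbinn n : qbin n n = 1.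
Proof. by elim: n => //= n ->; rewrite qbin_small ?mulr0 ?addr0. Qed.

Local Arguments qbin : simpl never.

(** Splitting off the factor j = 0 leaves the same product with [x * p] for [x], hence an induction
    with [x] general. *)
Lemma qbin_theorem (x y : R) n :
  \prod_(j < n) (y + x * p ^+ j) =
  \sum_(s < n.+1) p ^+ 'C(s, 2) * qbin n s * x ^+ s * y ^+ (n - s).
Proof.
elim: n x => [|n IHn] x; first by rewrite big_ord0 big_ord1 /= !mulr1.
rewrite big_ord_recl expr0 mulr1.
rewrite (eq_bigr (fun j : 'I_n => y + (x * p) * p ^+ j)); last first.
  by move=> j _; rewrite /= /bump add1n exprS mulrA.
rewrite IHn mulrDl big_distrr [in X in X + _]big_ord_recl.
rewrite [RHS]big_ord_recl !qbin0 !subn0 /=.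
rewrite -addrA; congr (_ + _); first by rewrite exprS; ring.
(* The added term s = n is zero; both sums then have the same range and merge by the Pascal rule. *)
have -> : \sum_(s < n) y * (p ^+ 'C(bump 0 s, 2) * qbin n (bump 0 s)
      * (x * p) ^+ bump 0 s * y ^+ (n - bump 0 s)) =
    \sum_(s < n.+1) p ^+ 'C(s.+1, 2) * (p ^+ s.+1 * qbin n s.+1)
      * x ^+ s.+1 * y ^+ (n - s).
  rewrite big_ord_recr /= qbin_small // !(mulr0, mul0r) addr0.
  apply: eq_bigr => s _; rewrite /bump add1n exprMn.
  have -> : (n - s = (n - s.+1).+1)%N by have := ltn_ord s; lia.
  by rewrite [y ^+ _.+1]exprS; ring.
rewrite big_distrr -big_split; apply: eq_bigr => s _ /=.
rewrite /bump add1n subSS qbinS binS bin1 addnC exprD exprMn.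
by rewrite ![_ ^+ s.+1]exprS; ring.
Qed.

(** Product formula with the denominator cleared. The two Pascal terms share all factors but one,
    and $(1-p^{a+1})+p^{a+1}(1-p^{b+1})=1-p^{a+b+2}$. *)
Lemma qbin_prod a b :
  qbin (a + b) a * \prod_(j < b) (1 - p ^+ j.+1) =
  \prod_(j < b) (1 - p ^+ (a + j.+1)).
Proof.
elim: a b => [|a IHa] b.
  by rewrite qbin0 mul1r; apply: eq_bigr => j _; rewrite add0n.
elim: b => [|b IHb]; first by rewrite addn0 qbinn !big_ord0 mulr1.
rewrite addSn qbinS mulrDl IHa addnS -addSn.
rewrite -[X in _ + X]mulrA [in X in _ + X]big_ord_recr /=.
rewrite [qbin _ _ * _]mulrA IHb.
rewrite big_ord_recl [RHS]big_ord_recr /=.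
rewrite (eq_bigr (fun j : 'I_b => 1 - p ^+ (a.+1 + j.+1))); last first.
  by move=> j _; rewrite /bump add1n !addnS addSn.
have -> : p ^+ (a.+1 + b.+1) = p ^+ a.+1 * p ^+ b.+1 by rewrite exprD.
by rewrite addn1; ring.
Qed.

End QBinomial.

Lemma prod_pow_bin2 (R : comNzRingType) (x : R) n :
  \prod_(j < n) x ^+ j = x ^+ 'C(n, 2).
Proof.
elim: n => [|n IHn]; first by rewrite big_ord0.
by rewrite big_ord_recr /= IHn binS bin1 exprD.
Qed.

(** * Polynomials modulo a power of X *)

Definition eqX (N : nat) (P Q : {poly int}) : Prop :=
  forall j, (j < N)%N -> P`_j = Q`_j.

Lemma eqX_sym N P Q : eqX N P Q -> eqX N Q P.
Proof. by move=> h j /h. Qed.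

Lemma eqX_trans N Q P T : eqX N P Q -> eqX N Q T -> eqX N P T.
Proof. by move=> h1 h2 j jN; rewrite h1 ?h2. Qed.

Lemma eqXD N P P' Q Q' : eqX N P P' -> eqX N Q Q' -> eqX N (P + Q) (P' + Q').
Proof. by move=> hP hQ j jN; rewrite !coefD hP ?hQ. Qed.

Lemma eqXM N P P' Q Q' : eqX N P P' -> eqX N Q Q' -> eqX N (P * Q) (P' * Q').
Proof.
move=> hP hQ j jN; rewrite !coefM; apply: eq_bigr => l _.
have := ltn_ord l => lj; rewrite hP ?hQ //; lia.
Qed.

Lemma eqXMl N P Q Q' : eqX N Q Q' -> eqX N (P * Q) (P * Q').
Proof. exact: eqXM. Qed.

Lemma eqX_prod1 N (I : Type) (r : seq I) (S : pred I) (P : I -> {poly int}) :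
  (forall j, S j -> eqX N (P j) 1) -> eqX N (\prod_(j <- r | S j) P j) 1.
Proof.
move=> h; apply: (big_ind (fun Q => eqX N Q 1)) => // Q Q' hQ hQ'.
by rewrite -(mulr1 1); apply: eqXM.
Qed.

Lemma eqX_1subXn N m : (N <= m)%N -> eqX N (1 - 'X^m) 1.
Proof.
move=> Nm j jN; rewrite coefB coefXn.
by case: eqP => [?|_]; [lia|rewrite subr0].
Qed.

(** By [qbin_prod] only factors $1-q^{km}$ with $m>\min(a,b)$ survive. This is the convergence of
    the Gaussian binomial to $1/(q^k;q^k)_\infty$, with an explicit precision. *)
Lemma eqX_qbin k a b : (0 < k)%N ->
  eqX (minn a b).+1
    (qbin 'X^k (a + b) a * \prod_(j < a + b) (1 - 'X^k ^+ j.+1)) 1.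
Proof.
move=> k0; rewrite [in \prod_(j < _) _]addnC big_split_ord /= mulrA.
rewrite qbin_prod -[X in eqX _ _ X]mulr1; apply: eqXM; apply: eqX_prod1 => j _.
  by rewrite -exprM; apply: eqX_1subXn; nia.
by rewrite -exprM; apply: eqX_1subXn; nia.
Qed.

(** * The Jacobi triple product *)

(* The summand of index m = s - N of the finite triple product, shifted by the
   factor q^D = q^(k N^2 + k N(N-1)/2 + i N) that clears negative powers, has
   exponent e + D with e = k m(m-1)/2 + i m. *)
Lemma jacobi_exponent k i N s : (1 <= i < k)%N -> (s <= N + N)%N ->
  k = 2 %[mod 4] -> i = 1 %[mod 4] ->
  exists e, [/\ (k * 'C(s, 2) + i * s + k * N * (N + N - s) =
                 e + (k * N * N + k * 'C(N, 2) + i * N))%N,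
                (e %% 4 <= 1)%N & (N < minn s (N + N - s) + e + 1)%N].
Proof.
have bin2D a b : ('C(a + b, 2) = 'C(a, 2) + 'C(b, 2) + a * b)%N.
  elim: a => [|a IHa]; first by rewrite add0n mul0n bin0n !addn0.
  by rewrite addSn !binS !bin1 IHa mulSn; lia.
have bin2x2 m : (2 * 'C(m, 2) + m = m * m)%N.
  by elim: m => // m IHm; rewrite binS bin1; lia.
have mod4 c d m : c = 2 %[mod 4] -> d = 1 %[mod 4] ->
    ((c * 'C(m, 2) + d * m) %% 4 <= 1)%N.
  move=> c2 d1; have -> : (c * 'C(m, 2) + d * m = m * m %[mod 4])%N.
    rewrite -bin2x2 -(modnDm (c * _)) -(modnMml c) -(modnMml d) c2 d1.
    by rewrite modnMml modnMml modnDm mul1n.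
  rewrite -modnMm; have : (m %% 4 < 4)%N by rewrite ltn_mod.
  by case: (m %% 4)%N => [|[|[|[|]]]].
(* Since $\min(s,2N-s)=N-|m|$, the last bound to prove says $|m|\le e$. *)
move=> ik sN k2 i1; have [Ns|sN'] := leqP N s.
  have [m sE] : exists m, s = (N + m)%N by exists (s - N)%N; lia.
  exists (k * 'C(m, 2) + i * m)%N; split; [|exact: mod4|].
    subst s; rewrite bin2D; have -> : (N + N - (N + m) = N - m)%N by lia.
    have [t NE] : exists t, N = (m + t)%N by exists (N - m)%N; lia.
    by subst N; rewrite addKn; ring.
  by rewrite sE; nia.
(* Here m = -l, so $e=k\,l(l-1)/2+(k-i)l$, and k - i is again 1 modulo 4. *)
have [l NE] : exists l, N = (s + l)%N by exists (N - s)%N; lia.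
have [k' kE] : exists k', k = (i + k')%N by exists (k - i)%N; lia.
exists (k * 'C(l, 2) + k' * l)%N; split.
- subst N; rewrite bin2D; have -> : (s + l + (s + l) - s = s + l + l)%N by lia.
  have := bin2x2 l; move: ('C(l, 2)) ('C(s, 2)) => u v h.
  by subst k; have := congr1 (muln (i + k')) h; nia.
- by apply: mod4 => //; lia.
by nia.
Qed.

(** The first two products expand into Gaussian binomials of size N + N. The third, with N + N
    factors, cancels their denominators, leaving terms $\pm q^e$ up to the needed degree. *)
Lemma jacobi_triple_support k i N n : (1 <= i < k)%N ->
  k = 2 %[mod 4] -> i = 1 %[mod 4] -> (n < N)%N -> (1 < n %% 4)%N ->
  (\prod_(j < N) (1 - 'X^i * 'X^k ^+ j) *
   \prod_(j < N) (1 - 'X^(k - i) * 'X^k ^+ j) *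
   \prod_(j < N + N) (1 - 'X^k ^+ j.+1) : {poly int})`_n = 0.
Proof.
move=> ik k2 i1 nN n4.
set B := \prod_(j < N) _; set C := \prod_(j < N) _; set E := \prod_(j < N + N) _.
pose D := (k * N * N + k * 'C(N, 2) + i * N)%N.
(* In the q-binomial theorem with y = p^N and x = -q^i, the factors j >= N give B
   and the factors j < N give C, up to sign and powers of q. *)
have key : (-1) ^+ N * (B * C) * 'X^D =
    \prod_(j < N + N) ('X^k ^+ N + - 'X^i * 'X^k ^+ j) :> {poly int}.
  have upper : \prod_(j < N) ('X^k ^+ N + - 'X^i * 'X^k ^+ (N + j)) =
      'X^(k * N * N) * B :> {poly int}.
    rewrite exprM -[X in _ ^+ X * B]card_ord -prodr_const -big_split.
    by apply: eq_bigr => j _ /=; rewrite exprM exprD; ring.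
  have lower : \prod_(j < N) ('X^k ^+ N + - 'X^i * 'X^k ^+ j) =
      (-1) ^+ N * 'X^(i * N) * 'X^(k * 'C(N, 2)) * C :> {poly int}.
    (* With p = q^k, factor j equals $-q^ip^j(1-q^{k-i}p^{N-1-j})$, so it pairs with factor N-1-j of
       [C]. *)
    rewrite /C [X in _ = _ * X](reindex_inj rev_ord_inj) /= exprM -exprMn.
    rewrite exprM -prod_pow_bin2 -[X in _ ^+ X * _]card_ord -prodr_const.
    rewrite -!big_split; apply: eq_bigr => j _ /=.
    have -> : 'X^k ^+ N = 'X^i * 'X^k ^+ j * ('X^(k - i) * 'X^k ^+ (N - j.+1)) :> {poly int}.
      by rewrite -!exprM -!exprD; congr ('X^_); have := ltn_ord j; nia.
    by ring.
  rewrite big_split_ord /= lower upper /D !exprD.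
  by move: ('X^(k * N * N)) ('X^(k * 'C(N, 2))) ('X^(i * N)) => u v w; ring.
have coefE : ((-1) ^+ N * (B * C * E))`_n = (((-1) ^+ N * (B * C) * 'X^D) * E)`_(n + D).
  have -> : (-1) ^+ N * (B * C) * 'X^D * E = (-1) ^+ N * (B * C * E) * 'X^D by ring.
  by rewrite coefMXn ltnNge leq_addl addnK.
suff : ((-1) ^+ N * (B * C * E))`_n = 0.
  rewrite -signr_odd; case: odd; last by rewrite mul1r.
  by rewrite expr1 mulN1r coefN => /eqP; rewrite oppr_eq0 => /eqP.
rewrite coefE key qbin_theorem mulr_suml coef_sum big1 // => s _.
have sN : (s <= N + N)%N by rewrite -ltnS.
have [e [eE e4 eN]] := jacobi_exponent ik sN k2 i1.
rewrite [X in polyseq X](_ : _ =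
    (-1) ^+ s * (qbin 'X^k (N + N) s * E * 'X^e) * 'X^D); last first.
  have XeD : 'X^e * 'X^D =
      'X^k ^+ 'C(s, 2) * 'X^i ^+ s * 'X^k ^+ N ^+ (N + N - s) :> {poly int}.
    by rewrite -exprD -eE !exprD !exprM.
  rewrite (exprNn 'X^i) -!mulrA XeD.
  move: ('X^k ^+ 'C(s, 2)) ('X^i ^+ s) ('X^k ^+ N ^+ (N + N - s)) => u v w.
  by move: ((-1) ^+ s) (qbin _ _ _) => x y; ring.
rewrite coefMXn ltnNge leq_addl addnK.
suff h : (qbin 'X^k (N + N) s * E * 'X^e)`_n = 0.
  by rewrite -signr_odd; case: odd; rewrite ?mul1r // expr1 mulN1r coefN h oppr0.
rewrite coefMXn; case: ltnP => // en.
(* [eN] puts n - e within the precision of [eqX_qbin]; a nonzero coefficient would force n = e,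
   against [e4] and [n4]. *)
have := @eqX_qbin k s (N + N - s); rewrite subnKC // => -> //; try lia.
rewrite coef1; case: eqP => // ?; lia.
Qed.

(** * Truncated power series *)

Definition trunc (N : nat) (f : fps) : {poly int} := \poly_(j < N) f j.

Lemma coef_trunc N f j : (j < N)%N -> (trunc N f)`_j = f j.
Proof. by move=> jN; rewrite coef_poly jN. Qed.

Lemma trunc_mul N f g : eqX N (trunc N (fps_mul f g)) (trunc N f * trunc N g).
Proof.
move=> j jN; rewrite coef_trunc // coefM; apply: eq_bigr => l _.
by have := ltn_ord l => lj; rewrite !coef_trunc //; lia.
Qed.

Lemma trunc_one N : eqX N (trunc N fps_one) 1.
Proof. by move=> j jN; rewrite coef_trunc // coef1. Qed.

Lemma trunc_inv N f : f 0%N \is a GRing.unit ->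
  eqX N (trunc N (fps_inv f) * trunc N f) 1.
Proof.
move=> f0; apply: eqX_trans (eqX_sym (@trunc_mul _ _ _)) _ => j jN.
by rewrite coef_trunc // fps_invP // coef1.
Qed.

Lemma trunc_qpoch N M (a p : {poly int}) : p`_0 = 0 -> (N <= M)%N ->
  eqX N (trunc N (qpoch a p)) (\prod_(m < M) (1 - a * p ^+ m)).
Proof.
by move=> p0 NM j jN; rewrite coef_trunc // (qpoch_stable _ p0) ?(leq_trans jN).
Qed.

Definition triple (k i : nat) : fps := qpochs [:: 'X^i; 'X^(k - i); 'X^k] 'X^k.

(** The last product has M + M factors only to match [jacobi_triple_support]; any number of at least
    N gives the same truncation. *)
Lemma trunc_triple k i N M : (0 < k)%N -> (N <= M)%N ->
  eqX N (trunc N (triple k i))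
    (\prod_(j < M) (1 - 'X^i * 'X^k ^+ j) *
     \prod_(j < M) (1 - 'X^(k - i) * 'X^k ^+ j) *
     \prod_(j < M + M) (1 - 'X^k ^+ j.+1)).
Proof.
move=> k0 NM; have Xk0 : ('X^k : {poly int})`_0 = 0 by rewrite coefXn; case: k k0.
rewrite /triple /qpochs !big_cons big_nil -mulrA.
apply: eqX_trans (@trunc_mul _ _ _) _; apply: eqXM; first exact: trunc_qpoch.
apply: eqX_trans (@trunc_mul _ _ _) _; apply: eqXM; first exact: trunc_qpoch.
apply: eqX_trans (@trunc_mul _ _ _) _; rewrite -[X in eqX _ _ X]mulr1.
apply: eqXM (@trunc_one N).
rewrite (eq_bigr (fun j : 'I_(M + M) => 1 - 'X^k * 'X^k ^+ j)).
  by apply: trunc_qpoch => //; lia.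
by move=> j _; rewrite exprS.
Qed.

Lemma triple_support k i n : (1 <= i < k)%N ->
  k = 2 %[mod 4] -> i = 1 %[mod 4] -> (1 < n %% 4)%N -> triple k i n = 0.
Proof.
move=> ik k2 i1 n4; rewrite -(@coef_trunc n.+1) // (@trunc_triple _ _ _ n.+1) //.
  exact: jacobi_triple_support.
by lia.
Qed.

(** * The theta function of Gauss *)

Lemma prod_even_odd (R : comNzRingType) (f : nat -> R) n :
  \prod_(j < n.*2) f j = \prod_(j < n) f j.*2 * \prod_(j < n) f j.*2.+1.
Proof.
elim: n => [|n IHn]; first by rewrite !big_ord0 mulr1.
by rewrite doubleS !big_ord_recr /= IHn; ring.
Qed.

(** Uses $(q)_\infty(-q)_\infty=(q^2;q^2)_\infty$ and $(q)_\infty=(q;q^2)_\infty(q^2;q^2)_\infty$;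
    [O], [E], [F], [G] are finite forms of $(q;q^2)_\infty$, $(q^2;q^2)_\infty$, $(q)_\infty$,
    $(-q)_\infty$. *)
Lemma gauss_theta N :
  eqX N (trunc N (triple 2 1) * trunc N (qpoch (- 'X) 'X))
        (trunc N (qpoch 'X 'X)).
Proof.
have X0 : ('X : {poly int})`_0 = 0 by rewrite coefX.
pose O : {poly int} := \prod_(j < N) (1 - 'X^1 * 'X^2 ^+ j).
pose E n : {poly int} := \prod_(j < n) (1 - 'X^2 ^+ j.+1).
pose F n : {poly int} := \prod_(j < n) (1 - 'X * 'X ^+ j).
pose G n : {poly int} := \prod_(j < n) (1 - - 'X * 'X ^+ j).
have FG n : F n * G n = E n.
  rewrite /F /G -big_split; apply: eq_bigr => j _ /=.
  by rewrite -exprM mulnC exprM (exprS _ j); ring.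
have OE : F N.*2 = O * E N.
  rewrite /F (prod_even_odd (fun j => 1 - 'X * 'X ^+ j)); congr (_ * _); apply: eq_bigr => j _.
    by rewrite -exprM mul2n.
  by rewrite -exprM -exprS mul2n doubleS.
have E2 : eqX N (E (N + N)%N) (E N).
  rewrite /E big_split_ord -[X in eqX _ _ X]mulr1; apply: eqXMl.
  by apply: eqX_prod1 => j _; rewrite -exprM; apply: eqX_1subXn => /=; lia.
have F2 : eqX N (F N.*2) (F N).
  by apply: eqX_trans (eqX_sym _) _; apply: trunc_qpoch => //; lia.
apply: (@eqX_trans _ (O * (F N * G N))).
  rewrite mulrA; apply: eqXM; last exact: trunc_qpoch.
  apply: eqX_trans (trunc_triple _ _ (leqnn N)) _ => //.
  rewrite -mulrA; apply: eqXMl; apply: eqX_trans F2; rewrite OE.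
  exact: eqXMl.
rewrite FG -OE; apply: eqX_trans F2 _.
exact/eqX_sym/trunc_qpoch.
Qed.

Lemma qpoch_neg_mod2 N : exists H : {poly int},
  eqX N (trunc N (qpoch (- 'X) 'X)) (trunc N (qpoch 'X 'X) + H *+ 2).
Proof.
have X0 : ('X : {poly int})`_0 = 0 by rewrite coefX.
suff [H hH] : exists H : {poly int}, \prod_(j < N) (1 - - 'X * 'X ^+ j) =
    \prod_(j < N) (1 - 'X * 'X ^+ j) + H *+ 2.
  exists H; apply: eqX_trans (trunc_qpoch _ X0 (leqnn N)) _; rewrite hH.
  by apply: eqXD => //; exact/eqX_sym/trunc_qpoch.
elim: N => [|N [H IHN]]; first by exists 0; rewrite !big_ord0 mul0rn addr0.
(* From $(P+2H)(1+x)=P(1-x)+2(H(1+x)+Px)$ with $x=q^{N+1}$. *)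
exists (H * (1 + 'X * 'X ^+ N) + \prod_(j < N) (1 - 'X * 'X ^+ j) * ('X * 'X ^+ N)).
by rewrite !big_ord_recr /= IHN; ring.
Qed.

Lemma theta_mod2 N : exists T : {poly int},
  [/\ eqX N (trunc N (triple 2 1)) (1 - T *+ 2) &
      forall n, (n < N)%N -> (1 < n %% 4)%N -> T`_n = 0].
Proof.
have [H hH] := qpoch_neg_mod2 N.
have hI := @trunc_inv N _ qpochXX_unit.
have phiGF := @gauss_theta N.
set phi := trunc N (triple 2 1) in phiGF *.
set G := trunc N (qpoch (- 'X) 'X) in hH phiGF.
set F := trunc N _ in hH phiGF hI.
set I := trunc N _ in hI.
(* Dividing [phi * (F + H *+ 2)] = [F] by [F] gives [phi] = 1 - 2 [phi * H * I], where [I] is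
   1/[F]. *)
exists (phi * H * I).
have hT : eqX N phi (1 - (phi * H * I) *+ 2).
  have h1 : eqX N (phi * (I * F) + (phi * H * I) *+ 2) 1.
    have -> : phi * (I * F) + (phi * H * I) *+ 2 = I * (phi * (F + H *+ 2)) by ring.
    apply: eqX_trans hI; apply: eqXMl; apply: eqX_trans phiGF.
    exact/eqXMl/eqX_sym.
  have h2 : eqX N phi (phi * (I * F)).
    by rewrite -[X in eqX _ X]mulr1; exact/eqXMl/eqX_sym.
  apply: eqX_trans h2 _.
  by rewrite -[phi * (I * F)](addrK ((phi * H * I) *+ 2)); apply: eqXD.
(* As n is not 0, the coefficient of [phi] is -2 times that of T, and it vanishes by
   [triple_support] at k = 2, i = 1. *)
split=> // n nN n4; have := hT n nN.
rewrite coef_trunc // triple_support // coefB coef1 coefMn.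
have -> : (n == 0%N) = false by apply/eqP => n0; rewrite n0 in n4.
by rewrite sub0r -mulr_natr => /esym/eqP; rewrite oppr_eq0 mulf_eq0 orbF => /eqP.
Qed.

(** * The congruence modulo 4 *)

Lemma trunc_Ski_theta k i N :
  eqX N (trunc N (triple 2 1) * trunc N (Ski k i)) (trunc N (triple k i)).
Proof.
have hI := @trunc_inv N _ qpochXX_unit.
have phiGF := @gauss_theta N.
set A := trunc N (triple k i).
apply: (@eqX_trans _ (A * (trunc N (fps_inv (qpoch 'X 'X)) *
   (trunc N (triple 2 1) * trunc N (qpoch (- 'X) 'X))))).
  set phi := trunc N (triple 2 1); set I := trunc N (fps_inv _).
  set G := trunc N (qpoch (- 'X) 'X).
  have -> : A * (I * (phi * G)) = phi * (G * A * I) by ring.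
  apply: eqXMl; apply: eqX_trans (@trunc_mul _ _ _) _; apply: eqXM => //.
  exact: trunc_mul.
rewrite -[X in eqX _ _ X]mulr1; apply: eqXMl; apply: eqX_trans hI.
exact: eqXMl.
Qed.

Local Close Scope ring_scope.

Theorem mainTheorem5 (k i : nat)
  (hi1 : (1 <= i)%N) (hik : (2 * i <= k)%N)
  (hk : k = 2 %[mod 4]) (hi : i = 1 %[mod 4]) (n : nat) :
  (Ski k i (4 * n + 3)%N = 0 %[mod 4])%Z.
Proof.
have ik : 1 <= i < k by lia.
pose N := 4 * n + 4; have nN : 4 * n + 3 < N by rewrite /N; lia.
have [T [hphi hT]] := theta_mod2 N.
have hSA := @trunc_Ski_theta k i N.
set phi := trunc N (triple 2 1) in hphi hSA.
set S := trunc N (Ski k i) in hSA; set A := trunc N (triple k i) in hSA.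
have SA : eqX N S (A + (T * S) *+ 2)%R.
  rewrite -[X in eqX _ X](subrK ((T * S) *+ 2)%R); apply: eqXD => //.
  have -> : (S - (T * S) *+ 2 = (1 - T *+ 2) * S)%R by ring.
  by apply: eqX_trans hSA; apply: eqXM => //; exact: eqX_sym.
(* Substituting [SA] into itself once leaves [S] only with the factor 4. *)
have SA2 : eqX N S (A + (T * A) *+ 2 + (T * T * S) *+ 4)%R.
  apply: (eqX_trans SA).
  have -> : (A + (T * A) *+ 2 + (T * T * S) *+ 4 =
    A + T *+ 2 * (A + (T * S) *+ 2))%R by ring.
  by rewrite -[X in eqX _ (_ + X)%R]mulrnAl; apply: eqXD => //; exact: eqXMl.
(* Two exponents that are 0 or 1 modulo 4 have a sum that is never 3 modulo 4. *)
have TA : ((T * A)`_(4 * n + 3)%N = 0)%R.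
  rewrite coefM big1 // => j _; have := ltn_ord j => jn.
  have [j4|j4] := leqP (j %% 4) 1; last by rewrite hT ?mul0r //; lia.
  by rewrite coef_trunc ?triple_support ?mulr0 //; lia.
rewrite -(coef_trunc (Ski k i) nN) -/S SA2 // !coefD TA.
rewrite coef_trunc // triple_support //; last by lia.
by lia.
Qed.
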